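(* The renormalized series $$\mathcal T^{(\mathrm{ren})}_{\mu*\Lambda}(z):=\sum_{i=1}^{\infty}(\mu*\Lambda)(i)\,\bigl(\phi_i(z)-\phi_\infty(z)\bigr)$$ converges absolutely and locally uniformly on $\mathbb C$ and hence defines an entire function. Moreover, for every integer $n\ge1$, $$\mathcal T^{(\mathrm{ren})}_{\mu*\Lambda}(n)=\Lambda(n).$$
   Context: For $z\in\mathbb C$ and an integer $i\ge2$, $F(z,i)=i+2\sum_{k=1}^{i-1}(i-k)\cos(2\pi kz/i)$, and $F(z,1):=1$; set $\phi_i(z):=F(z,i)/i^2$. Also $\phi_\infty(z):=\left(\frac{\sin(\pi z)}{\pi z}\right)^2$ with $\phi_\infty(0):=1$. $\mu$ is the Möbius function, $\Lambda$ the von Mangoldt function, and $*$ is Dirichlet convolution, $(f*g)(n)=\sum_{d\mid n}f(d)g(n/d)$. *)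

(* Defs.v *)
From Stdlib Require Import Reals.
From Coquelicot Require Import Coquelicot.
From mathcomp Require Import all_boot.

Set Implicit Arguments.
Unset Strict Implicit.
Unset Printing Implicit Defensive.

Local Open Scope nat_scope.

(** Arithmetic functions are functions on [nat] whose value at [0] is
    irrelevant. *)

Definition mobius (n : nat) : R :=
  if all (fun p => logn p n == 1) (primes n) then pow (-1) (size (primes n))
  else R0.

(* [primes n] is duplicate-free, so it is a singleton [[:: p]] exactly when
   [n] is a power [p ^ k] with [p] prime and [k >= 1]. *)
Definition vonMangoldt (n : nat) : R :=
  if primes n is [:: p] then ln (INR p) else R0.

Lemma vonMangoldt_pexp (p k : nat) :
  prime p -> 0 < k -> vonMangoldt (p ^ k) = ln (INR p).
Proof.
by move=> pp k0; rewrite /vonMangoldt primesX // primes_prime.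
Qed.

Lemma vonMangoldt_eq0 (n : nat) : 0 < n ->
  (forall p k, prime p -> 0 < k -> n <> p ^ k) -> vonMangoldt n = R0.
Proof.
move=> n0 H; rewrite /vonMangoldt.
case E: (primes n) => [|p [|q s]] //; exfalso.
have : p \in primes n by rewrite E inE.
rewrite mem_primes => /and3P[pp _ pn].
apply: (H p (logn p n)) => //; first by rewrite -pfactor_dvdn.
by rewrite {1}(prod_prime_decomp n0) prime_decompE E /= big_seq1.
Qed.

Definition dconv (f g : nat -> R) (n : nat) : R :=
  \big[Rplus/R0]_(d <- divisors n) Rmult (f d) (g (n %/ d)).

Local Open Scope R_scope.

Definition Cexp (z : C) : C :=
  (exp (Re z) * cos (Im z), exp (Re z) * sin (Im z)).

Local Open Scope C_scope.

Definition Ccos (z : C) : C := (Cexp (Ci * z) + Cexp (- (Ci * z))) / 2.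

Definition Csin (z : C) : C := (Cexp (Ci * z) - Cexp (- (Ci * z))) / (2 * Ci).

Definition Fker (z : C) (i : nat) : C :=
  if i == 1%N then RtoC 1
  else INR i + 2 * sum_n_m (fun k : nat =>
         INR (i - k)%N * Ccos (2 * PI * INR k * z / INR i)) 1%N (i - 1)%N.

Definition phi (i : nat) (z : C) : C := Fker z i / INR i ^ 2.

Definition phi_oo (z : C) : C :=
  if Ceq_dec z 0 then RtoC 1 else (Csin (PI * z) / (PI * z)) ^ 2.

Definition ren_term (f : nat -> R) (i : nat) (z : C) : C :=
  f i * (phi i z - phi_oo z).

(* [Series] is Coquelicot's total real series, which is meaningful only under
   convergence. *)
Definition CSeries (a : nat -> C) : C :=
  (Series (fun k => Re (a k)), Series (fun k => Im (a k))).

(* The paper's series starts at [i = 1], Coquelicot's at [0]. *)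
Definition T_ren (f : nat -> R) (z : C) : C :=
  CSeries (fun k => ren_term f k.+1 z).

Definition cvg_locally_uniformly (u : nat -> C -> C) (g : C -> C) : Prop :=
  forall z0 : C, exists r : posreal, forall eps : posreal,
    eventually (fun N : nat => forall z : C,
      Cmod (z - z0) < r -> Cmod (u N z - g z) < eps).

Definition entire (g : C -> C) : Prop :=
  forall z : C, @ex_derive C_AbsRing C_NormedModule g z.

(* Main.v *)
Require Import Defs.
From Stdlib Require Import Reals Lra IndefiniteDescription.
From Coquelicot Require Import Coquelicot.
From HB Require Import structures.
From mathcomp Require Import all_boot.

(** Two estimates make the renormalised series converge: the coefficients satisfy
    |mu * Lambda (i)| <= ln i, and [phi i - phi_oo] is O(1/i^2) uniformly on every
    disk. Since the sum of ln i / i^2 is finite, the Weierstrass M-test applies.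

    The coefficient bound is |mu * Lambda| <= 1 * Lambda <= ln
    ([dconv_mobius_vonMangoldt_bound]).

    The kernel estimate comes from a doubling identity. The Fejer kernel factors as
    a product of two geometric sums, with ratios exp(2 pi i z / n) and its inverse
    ([phi_geom]), and splitting a geometric sum of length 2n gives
    phi_(2n)(z) = phi_n(z) cos^2 (pi z / 2n) ([phi_double]). Thus
    phi_n - phi_(2n) = phi_n(z) sin^2 (pi z / 2n) is O(1/n^2) on disks, where phi_n
    is bounded uniformly in n as a product of two averages of exponentials.
    Telescoping over n, 2n, 4n, ... bounds phi_n - phi_oo by a geometric series
    ([jet_bound_phi_renorm]); that the telescoping limit is phi_oo follows from the
    closed forms of phi_n and phi_oo ([phi_cvg]).

    Holomorphy of the sum is obtained without contour integrals. Instead of mere sup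
    norms, every estimate above is carried out for [jet_bound], which controls the
    value, the derivative and the second order Taylor remainder on a disk at once.
    These bounds are stable under sums, products and dominated series
    ([jet_bound_series]), and for exponentials they follow from
    exp(z + h) = exp(z) exp(h) and the expansion of exp at 0. Having them on every
    disk makes a function entire ([jet_bound_ex_derive]).

    At an integer n >= 1, phi_oo vanishes, and phi_i is 1 if i divides n and 0
    otherwise ([phi_nat]), because a full geometric sum over a nontrivial root of
    unity is 0. The series therefore reduces to the sum of mu * Lambda over the
    divisors of n, which is (1 * mu) * Lambda = Lambda at n ([sum_dconv_mobius]). *)

(* From here on [%R] is again the scope of the real numbers. *)
Delimit Scope R_scope with R.

(** * Divisor sums of the Moebius and von Mangoldt functions *)

Section ArithmeticFunctions.

Local Open Scope R_scope.

Let RplusA : associative Rplus.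
Proof. by move=> x y z; rewrite Rplus_assoc. Qed.

HB.instance Definition _ :=
  Monoid.isComLaw.Build R R0 Rplus RplusA Rplus_comm Rplus_0_l.

Let Rmult_sumr (I : Type) (r : seq I) (P : pred I) (F : I -> R) (c : R) :
  c * \big[Rplus/R0]_(i <- r | P i) F i =
  \big[Rplus/R0]_(i <- r | P i) (c * F i).
Proof. by apply: big_morph => [x y|]; ring. Qed.

(** Multiplication by [d] identifies the divisors of [n / d] with the multiples of
    [d] among the divisors of [n]; this bijection reindexes the sums of
    [sum_divisors_dconv] and [sum_mobius]. *)
Lemma perm_divisors_multiples (n d : nat) : (0 < n)%N -> (d %| n)%N ->
  perm_eq [seq i <- divisors n | d %| i]
          [seq (d * e)%N | e <- divisors (n %/ d)].
Proof.
move=> n0 dn; have d0 : (0 < d)%N by apply: dvdn_gt0 dn.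
have nd0 : (0 < n %/ d)%N by rewrite divn_gt0 // dvdn_leq.
apply: uniq_perm.
- by rewrite filter_uniq // divisors_uniq.
- rewrite map_inj_uniq ?divisors_uniq // => x y /eqP.
  by rewrite eqn_pmul2l // => /eqP.
move=> i; rewrite mem_filter -dvdn_divisors //.
apply/andP/mapP => [[di iN]|[e eN ->]].
  exists (i %/ d)%N; last by rewrite mulnC divnK.
  by rewrite -dvdn_divisors // dvdn_divRL // divnK.
rewrite dvdn_mulr //; split=> //.
move: eN; rewrite -dvdn_divisors // => eN.
by rewrite -(divnK dn) mulnC dvdn_mul.
Qed.

Lemma sum_divisors_multiples (n d : nat) (G : nat -> R) :
  (0 < n)%N -> (d %| n)%N ->
  \big[Rplus/R0]_(i <- divisors n | d %| i) G i =
  \big[Rplus/R0]_(e <- divisors (n %/ d)) G (d * e)%N.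
Proof.
move=> n0 dn; rewrite -big_filter (perm_big _ (perm_divisors_multiples _ _ n0 dn)).
by rewrite big_map.
Qed.

Lemma sum_divisors_compl (n : nat) (G : nat -> R) : (0 < n)%N ->
  \big[Rplus/R0]_(d <- divisors n) G (n %/ d)%N =
  \big[Rplus/R0]_(d <- divisors n) G d.
Proof.
move=> n0; rewrite -(big_map (fun d => n %/ d)%N xpredT G).
apply: perm_big; apply: uniq_perm; last 1 first.
- move=> i; apply/mapP/idP => [[d dn ->]|di].
    by move: dn; rewrite -!dvdn_divisors // => /dvdn_div.
  move: di; rewrite -dvdn_divisors // => di.
  exists (n %/ i)%N; first by rewrite -dvdn_divisors // dvdn_div.
  by rewrite divnA // mulKn.
- rewrite map_inj_in_uniq ?divisors_uniq // => x y.
  rewrite -!dvdn_divisors // => xn yn E.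
  by rewrite -[LHS](mulKn _ n0) -divnA // E divnA // mulKn.
- exact: divisors_uniq.
Qed.

(** Summing over all divisors is convolution with the constant function 1, so this
    is the associativity and commutativity 1 * (f * g) = g * (1 * f). Both sides
    range over the chains e | i | n, and the order of summation is exchanged. *)
Lemma sum_divisors_dconv (f g : nat -> R) (n : nat) : (0 < n)%N ->
  \big[Rplus/R0]_(i <- divisors n) dconv f g i =
  \big[Rplus/R0]_(e <- divisors n)
     (g e * \big[Rplus/R0]_(d <- divisors (n %/ e)) f d).
Proof.
move=> n0; rewrite /dconv.
transitivity (\big[Rplus/R0]_(i <- divisors n)
  \big[Rplus/R0]_(e <- divisors n | e %| i) (g e * f (i %/ e)%N)).
  apply: eq_big_seq => i; rewrite -dvdn_divisors // => iN.
  have i0 : (0 < i)%N by apply: dvdn_gt0 iN.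
  rewrite -(sum_divisors_compl i (fun d => f d * g (i %/ d)%N)) //.
  rewrite -[RHS]big_filter.
  rewrite [RHS](perm_big (divisors i)); last first.
    apply: uniq_perm; rewrite ?filter_uniq ?divisors_uniq // => e.
    rewrite mem_filter -!dvdn_divisors //.
    by case ei: (e %| i) => //=; rewrite (dvdn_trans ei).
  apply: eq_big_seq => e; rewrite -dvdn_divisors // => ei.
  by rewrite divnA // mulKn // Rmult_comm.
rewrite (exchange_big_dep xpredT) //=.
apply: eq_big_seq => e; rewrite -dvdn_divisors // => eN.
have e0 : (0 < e)%N by apply: dvdn_gt0 eN.
rewrite sum_divisors_multiples // Rmult_sumr.
by apply: eq_bigr => d _; rewrite mulKn.
Qed.

Lemma mobius_prime_mul (p e : nat) : prime p -> (0 < e)%N ->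
  mobius (p * e) = if (p %| e)%N then 0 else - mobius e.
Proof.
move=> pp e0; have p0 := prime_gt0 pp.
have logE q : logn q (p * e) = ((q == p) + logn q e)%N.
  by rewrite lognM // logn_prime.
case: ifPn => pe; rewrite /mobius.
  case: ifP => // /allP /(_ p).
  rewrite mem_primes pp muln_gt0 p0 e0 dvdn_mulr // => /(_ isT).
  by rewrite logE eqxx eqSS -leqn0 leqNgt logn_gt0 mem_primes pp e0 pe.
have pE : perm_eq (primes (p * e)) (p :: primes e).
  apply: uniq_perm; rewrite ?primes_uniq //=.
    by rewrite primes_uniq mem_primes (negbTE pe) !andbF.
  by move=> q; rewrite primesM // primes_prime // !inE.
rewrite (perm_all _ pE) (perm_size pE) /= logE eqxx.
have -> : logn p e = 0%N by apply/eqP; rewrite lognE (negbTE pe) !andbF.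
have -> : all (fun q => logn q (p * e) == 1%N) (primes e) =
          all (fun q => logn q e == 1%N) (primes e).
  apply: eq_in_all => q; rewrite mem_primes => /and3P[_ _ qe].
  by rewrite logE; case: (q =P p) => // qp; rewrite -qp qe in pe.
by case: (all _ _) => /=; [ring | rewrite Ropp_0].
Qed.

(** For a prime [p] dividing [n], the squarefree divisors of [n] pair up as [e] and
    [p * e] with [e] prime to [p], and the two values of the Moebius function
    cancel. *)
Lemma sum_mobius (n : nat) : (0 < n)%N ->
  \big[Rplus/R0]_(d <- divisors n) mobius d = if (n == 1)%N then 1 else 0.
Proof.
move=> n0; case: (ltngtP n 1) => [|n1|->]; last by rewrite big_seq1.
  by rewrite ltnNge n0.
have pp : prime (pdiv n) by exact: pdiv_prime.
have pn : pdiv n %| n by exact: pdiv_dvd.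
move: (pdiv n) pp pn => p pp pn; have p0 := prime_gt0 pp.
rewrite (bigID (fun d => p %| d)) /= sum_divisors_multiples //.
have m0 : (0 < n %/ p)%N by rewrite divn_gt0 // dvdn_leq.
have -> : \big[Rplus/R0]_(e <- divisors (n %/ p)) mobius (p * e) =
  \big[Rplus/R0]_(e <- divisors (n %/ p) | ~~ (p %| e)) (- mobius e).
  rewrite [RHS]big_mkcond; apply: eq_big_seq => e.
  rewrite -dvdn_divisors // => eN; rewrite mobius_prime_mul ?(dvdn_gt0 m0) //.
  by case: ifP.
rewrite -[X in X + _]big_filter -[X in _ + X]big_filter.
(* An [e] prime to [p] divides [n] exactly when it divides [n / p]. *)
rewrite [X in X + _](perm_big [seq d <- divisors n | ~~ (p %| d)]); last first.
  apply: uniq_perm; rewrite ?filter_uniq ?divisors_uniq // => e.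
  rewrite !mem_filter -!dvdn_divisors //; case pe: (p %| e) => //=.
  by rewrite -{2}(divnK pn) Gauss_dvdl // coprime_sym prime_coprime // pe.
by rewrite -big_split big1 // => e _ /=; ring.
Qed.

(** As 1 * mu is the unit of Dirichlet convolution, 1 * (mu * g) = g. *)
Lemma sum_dconv_mobius (g : nat -> R) (n : nat) : (0 < n)%N ->
  \big[Rplus/R0]_(i <- divisors n) dconv mobius g i = g n.
Proof.
move=> n0; rewrite sum_divisors_dconv //.
rewrite (bigD1_seq n) ?divisors_id ?divisors_uniq //=.
rewrite divnn n0 sum_mobius // eqxx big1_seq ?Rmult_1_r ?Rplus_0_r //.
move=> e /andP[en]; rewrite -dvdn_divisors // => eN.
have e0 : (0 < e)%N by apply: dvdn_gt0 eN.
have ne0 : (0 < n %/ e)%N by rewrite divn_gt0 // dvdn_leq.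
rewrite (sum_mobius _ ne0); case: eqP => [E|_]; last exact: Rmult_0_r.
by move: en; rewrite -(divnK eN) E mul1n eqxx.
Qed.

Lemma vonMangoldt_ge0 (n : nat) : 0 <= vonMangoldt n.
Proof.
rewrite /vonMangoldt; case E: (primes n) => [|p [|q s]]; try exact: Rle_refl.
have /prime_gt0/ltP pp : prime p.
  have : p \in primes n by rewrite E inE.
  by rewrite mem_primes => /andP[].
rewrite -ln_1; apply: ln_le; [lra|].
by apply: (le_INR 1).
Qed.

(** The engine of the induction in [sum_vonMangoldt_le]: multiplying [m] by [p]
    creates at most one new prime power divisor, the full power of [p]. *)
Lemma vonMangoldt_multiple (p m d : nat) : prime p -> (0 < m)%N ->
  (d %| p * m)%N -> ~~ (d %| m)%N -> d <> (p ^ logn p (p * m))%N ->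
  vonMangoldt d = 0.
Proof.
move=> pp m0 dpm dm dE; have p0 := prime_gt0 pp.
have pm0 : (0 < p * m)%N by rewrite muln_gt0 p0.
have d0 : (0 < d)%N by apply: dvdn_gt0 dpm.
apply: vonMangoldt_eq0 => // q k qp k0 dq; subst d.
move: dpm dm; rewrite !pfactor_dvdn // -ltnNge => k1 k2.
have qE : q = p.
  move: k1; rewrite lognM // logn_prime //; case: eqP => // _ k1.
  by move: (leq_ltn_trans k1 k2); rewrite ltnn.
subst q; apply: dE; congr (_ ^ _)%N; apply/eqP.
rewrite eqn_leq k1 /= lognM // logn_prime // eqxx.
by rewrite add1n.
Qed.

(** Removing one prime factor [p] from [n] lowers the logarithm by
    [ln p] and, by [vonMangoldt_multiple], the sum by the single term [ln p]. *)
Lemma sum_vonMangoldt_le (n : nat) : (0 < n)%N ->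
  \big[Rplus/R0]_(d <- divisors n) vonMangoldt d <= ln (INR n).
Proof.
elim/ltn_ind: n => n IH n0.
case: (ltngtP n 1) => [|n1|->]; first by rewrite ltnNge n0.
  2: by rewrite big_seq1 /vonMangoldt /= ln_1; exact: Rle_refl.
have pp : prime (pdiv n) by exact: pdiv_prime.
have pn : pdiv n %| n by exact: pdiv_dvd.
move: (pdiv n) pp pn => p pp pn; have p0 := prime_gt0 pp.
have p1 := prime_gt1 pp.
set m := (n %/ p)%N; have m0 : (0 < m)%N by rewrite divn_gt0 // dvdn_leq.
have nE : n = (p * m)%N by rewrite mulnC divnK.
have mn : (m < n)%N by rewrite nE ltn_Pmull.
have {}IH := IH m mn m0.
have -> : ln (INR n) = ln (INR m) + ln (INR p).
  rewrite nE mult_INR ln_mult; first ring; by apply: (lt_INR 0); apply/ltP.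
rewrite (bigID (fun d => d %| m)) /=; apply: Rplus_le_compat.
  rewrite -big_filter.
  rewrite (perm_big (divisors m)) //.
  apply: uniq_perm; rewrite ?filter_uniq ?divisors_uniq // => e.
  rewrite mem_filter -!dvdn_divisors //.
  by case em: (e %| m) => //=; rewrite nE dvdn_mull.
have pk0 : (0 < logn p n)%N by rewrite logn_gt0 mem_primes pp n0.
have pkn : (p ^ logn p n)%N \in divisors n by rewrite -dvdn_divisors // pfactor_dvdnn.
rewrite big_mkcond /= (bigD1_seq _ pkn) ?divisors_uniq //=.
rewrite (big1_seq (I := nat)).
  have -> : (p ^ logn p n %| m) = false.
    by rewrite pfactor_dvdn // nE lognM // logn_prime // eqxx add1n ltnn.
  by rewrite /= vonMangoldt_pexp // Rplus_0_r; exact: Rle_refl.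
move=> d /andP[dE]; rewrite -dvdn_divisors // => dn.
case: ifPn => // dm; apply: (@vonMangoldt_multiple p m) => //; rewrite -?nE //.
exact/eqP.
Qed.

Lemma mobius_bound (n : nat) : Rabs (mobius n) <= 1.
Proof.
rewrite /mobius; case: ifP => _; last by rewrite Rabs_R0; lra.
by rewrite pow_1_abs; lra.
Qed.

(** As |mu| is at most 1, |mu * Lambda| is at most 1 * Lambda. *)
Lemma dconv_mobius_vonMangoldt_bound (n : nat) : (0 < n)%N ->
  Rabs (dconv mobius vonMangoldt n) <= ln (INR n).
Proof.
move=> n0; apply: Rle_trans (sum_vonMangoldt_le n n0).
rewrite -[X in _ <= X]sum_divisors_compl // /dconv.
apply: (big_ind2 (fun x y => Rabs x <= y)) => [|x1 x2 y1 y2 H1 H2|d _].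
- by rewrite Rabs_R0; exact: Rle_refl.
- by apply: Rle_trans (Rabs_triang _ _) _; apply: Rplus_le_compat.
rewrite Rabs_mult [X in _ * X]Rabs_pos_eq; last exact: vonMangoldt_ge0.
have := mobius_bound d; have := vonMangoldt_ge0 (n %/ d); nra.
Qed.

End ArithmeticFunctions.

(** * Dominated complex series *)

Section ComplexSeries.

Local Open Scope R_scope.

Implicit Types (a : nat -> C) (b : nat -> R).

Lemma sum_n_Re a (N : nat) : Re (sum_n a N) = sum_n (fun k => Re (a k)) N.
Proof. by elim: N => [|N IH]; rewrite ?sum_O // !sum_Sn -IH. Qed.

Lemma sum_n_Im a (N : nat) : Im (sum_n a N) = sum_n (fun k => Im (a k)) N.
Proof. by elim: N => [|N IH]; rewrite ?sum_O // !sum_Sn -IH. Qed.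

(** Dominated series converge by completeness of the complex plane; the coordinates
    of the limit are then the two real sums of [CSeries]. *)
Lemma is_series_CSeries a b : (forall k, Cmod (a k) <= b k) -> ex_series b ->
  is_series (V := C_NormedModule) a (CSeries a).
Proof.
move=> ab bs.
have [L aL] : ex_series (V := C_CompleteNormedModule) a.
  by apply: (ex_series_le (V := C_CompleteNormedModule) _ b) => // k; rewrite -Cmod_norm.
suff -> : CSeries a = L by [].
have re : is_series (V := R_NormedModule) (fun k => Re (a k)) (Re L).
  apply: (filterlim_ext (fun N => Re (sum_n a N))); first exact: sum_n_Re.
  apply: filterlim_comp; first exact: aL.
  by apply: (continuous_fst (U := R_UniformSpace) (V := R_UniformSpace)).
have im : is_series (V := R_NormedModule) (fun k => Im (a k)) (Im L).
  apply: (filterlim_ext (fun N => Im (sum_n a N))); first exact: sum_n_Im.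
  apply: filterlim_comp; first exact: aL.
  by apply: (continuous_snd (U := R_UniformSpace) (V := R_UniformSpace)).
rewrite /CSeries (is_series_unique _ _ re) (is_series_unique _ _ im).
by case: L {aL re im}.
Qed.

Lemma Cmod_is_series_le a (l : C) b : (forall k, Cmod (a k) <= b k) ->
  is_series (V := C_NormedModule) a l -> ex_series b -> Cmod l <= Series b.
Proof.
move=> ab al bs.
have lim : is_lim_seq (fun N => Cmod (sum_n a N)) (Cmod l).
  apply: (filterlim_comp _ _ _ (sum_n a) Cmod _ _ _ al).
  exact: (filterlim_norm (V := C_NormedModule)).
have limb : is_lim_seq (sum_n b) (Series b) := Series_correct _ bs.
apply: (is_lim_seq_le _ _ _ _ _ lim limb) => N.
apply: Rle_trans (sum_n_m_le _ _ 0 N ab).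
exact: (norm_sum_n_m (V := C_NormedModule) a 0 N).
Qed.

Lemma is_series_tail {K : AbsRing} {V : NormedModule K} (a : nat -> V) (l : V)
    (N : nat) : is_series a l ->
  is_series (fun k => a (N.+1 + k)%coq_nat) (minus l (sum_n a N)).
Proof.
move=> al; apply: is_series_incr_n; first exact: le_n_S _ _ (Nat.le_0_l N).
by rewrite /minus /= -plus_assoc plus_opp_l plus_zero_r.
Qed.

(** The uniform tail estimate of the Weierstrass M-test: the right side does not
    mention [a], hence not the point at which a series of functions is evaluated. *)
Lemma CSeries_tail_le a b (N : nat) : (forall k, Cmod (a k) <= b k) ->
  ex_series b -> Cmod (sum_n a N - CSeries a)%C <= Series b - sum_n b N.
Proof.
move=> ab bs; rewrite -Cmod_opp.
have bt := is_series_tail _ _ N (Series_correct _ bs).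
have -> : (- (sum_n a N - CSeries a) = CSeries a - sum_n a N)%C by ring.
rewrite -[X in _ <= X](is_series_unique _ _ bt).
apply: (Cmod_is_series_le _ _ _ _ (is_series_tail _ _ N (is_series_CSeries _ _ ab bs))).
  by move=> k; apply: ab.
by eexists; exact: bt.
Qed.

End ComplexSeries.

(** * Second order bounds on disks *)

Section JetBounds.

Local Open Scope C_scope.

(** A bound on the disk of radius [r] for the value, the derivative [d] and the
    second order Taylor remainder, with one constant. Unlike differentiability it
    is quantitative, so it survives sums of series with summable constants; this
    replaces the Cauchy estimates in proving that a limit is holomorphic. The
    derivative is existential because only its bound matters. *)
Definition jet_bound (r M : R) (u : C -> C) : Prop :=
  exists d : C -> C, forall z w : C, (Cmod z <= r)%R -> (Cmod w <= r)%R ->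
    [/\ (Cmod (u z) <= M)%R, (Cmod (d z) <= M)%R
      & (Cmod (u w - u z - d z * (w - z)) <= M * Cmod (w - z) ^ 2)%R].

Implicit Types (r M N : R) (u v : C -> C).

Lemma jet_bound_ext r M u v : (forall z, (Cmod z <= r)%R -> u z = v z) ->
  jet_bound r M u -> jet_bound r M v.
Proof. by move=> uv [d H]; exists d => z w zr wr; rewrite -!uv //; apply: H. Qed.

Lemma jet_bound_le r M N u : (M <= N)%R -> jet_bound r M u -> jet_bound r N u.
Proof.
move=> MN [d H]; exists d => z w zr wr; have [H1 H2 H3] := H z w zr wr.
split; [lra | lra |]; apply: Rle_trans H3 _.
by apply: Rmult_le_compat_r => //; apply: pow2_ge_0.
Qed.

Lemma jet_bound_const r (c : C) : jet_bound r (Cmod c) (fun _ => c).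
Proof.
exists (fun _ => 0) => z w _ _; have c0 := Cmod_ge_0 c.
split; [exact: Rle_refl | by rewrite Cmod_0 |].
replace (c - c - 0 * (w - z)) with (RtoC 0) by ring.
by rewrite Cmod_0; apply: Rmult_le_pos => //; apply: pow2_ge_0.
Qed.

Lemma jet_bound_add r M N u v : jet_bound r M u -> jet_bound r N v ->
  jet_bound r (M + N) (fun z => u z + v z).
Proof.
move=> [d H] [e K]; exists (fun z => d z + e z) => z w zr wr.
have [H1 H2 H3] := H z w zr wr; have [K1 K2 K3] := K z w zr wr.
split; try by (apply: Rle_trans (Cmod_triangle _ _) _; lra).
replace (_ - _ - _) with
  ((u w - u z - d z * (w - z)) + (v w - v z - e z * (w - z))) by ring.
by apply: Rle_trans (Cmod_triangle _ _) _; lra.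
Qed.

Lemma jet_bound_scal r M (c : C) u : jet_bound r M u ->
  jet_bound r (Cmod c * M) (fun z => c * u z).
Proof.
move=> [d H]; exists (fun z => c * d z) => z w zr wr.
have [H1 H2 H3] := H z w zr wr; have c0 := Cmod_ge_0 c.
split; rewrite ?Cmod_mult; try exact: Rmult_le_compat_l.
replace (_ - _ - _) with (c * (u w - u z - d z * (w - z))) by ring.
by rewrite Cmod_mult Rmult_assoc; apply: Rmult_le_compat_l.
Qed.

Lemma jet_bound_opp r M u : jet_bound r M u -> jet_bound r M (fun z => u (- z)).
Proof.
move=> [d H]; exists (fun z => - d (- z)) => z w zr wr.
have [] := H (- z) (- w); rewrite ?Cmod_opp // => H1 H2.
replace (- w - - z) with (- (w - z)) by ring; rewrite Cmod_opp => H3.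
split=> //.
by replace (- d (- z) * (w - z)) with (d (- z) * - (w - z)) by ring.
Qed.

(** Leibniz rule. The factor [3 + 2 * r] comes from the Lipschitz constant
    [N * (1 + 2 * r)] of [v], obtained from its remainder on a disk of diameter
    [2 * r]. *)
Lemma jet_bound_mul r M N u v : jet_bound r M u -> jet_bound r N v ->
  jet_bound r ((3 + 2 * r) * (M * N)) (fun z => u z * v z).
Proof.
move=> [d H] [e K]; exists (fun z => d z * v z + u z * e z) => z w zr wr.
have [H1 H2 H3] := H z w zr wr; have [K1 K2 K3] := K z w zr wr.
have [K1' _ _] := K w z wr zr.
have r0 : (0 <= r)%R by apply: Rle_trans zr; apply: Cmod_ge_0.
have M0 : (0 <= M)%R by apply: Rle_trans H1; apply: Cmod_ge_0.
have N0 : (0 <= N)%R by apply: Rle_trans K1; apply: Cmod_ge_0.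
have MN0 : (0 <= M * N)%R by apply: Rmult_le_pos.
have rMN0 : (0 <= r * (M * N))%R by apply: Rmult_le_pos.
have mulb x y A B : (Cmod x <= A)%R -> (Cmod y <= B)%R ->
    (Cmod (x * y) <= A * B)%R.
  by move=> xA yB; rewrite Cmod_mult; apply: Rmult_le_compat => //; apply: Cmod_ge_0.
have h0 := Cmod_ge_0 (w - z); set h := Cmod (w - z) in h0 H3 K3 *.
have h2r : (h <= 2 * r)%R.
  by apply: Rle_trans (Cmod_triangle _ _) _; rewrite Cmod_opp; lra.
split.
- by apply: Rle_trans (mulb _ _ _ _ H1 K1) _; lra.
- apply: Rle_trans (Cmod_triangle _ _) _.
  by have := mulb _ _ _ _ H2 K1; have := mulb _ _ _ _ H1 K2; lra.
have dv : (Cmod (v w - v z) <= N * (1 + 2 * r) * h)%R.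
  replace (v w - v z) with ((v w - v z - e z * (w - z)) + e z * (w - z)) by ring.
  apply: Rle_trans (Cmod_triangle _ _) _.
  have := mulb _ _ _ _ K2 (Rle_refl h).
  have : (N * h * h <= N * h * (2 * r))%R.
    by apply: Rmult_le_compat_l => //; apply: Rmult_le_pos.
  by lra.
replace (_ - _ - _) with ((u w - u z - d z * (w - z)) * v w +
  (u z * (v w - v z - e z * (w - z)) + (d z * (w - z)) * (v w - v z))) by ring.
apply: Rle_trans (Cmod_triangle _ _) _.
have := mulb _ _ _ _ H3 K1'.
have := Cmod_triangle (u z * (v w - v z - e z * (w - z))) (d z * (w - z) * (v w - v z)).
have := mulb _ _ _ _ H1 K3.
have := mulb _ _ _ _ (mulb _ _ _ _ H2 (Rle_refl h)) dv.
by lra.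
Qed.

(** Weierstrass theorem in quantitative form: the derivatives are bounded by the
    same summable constants, so they may be summed termwise, and the Taylor
    remainder of the sum is the sum of the remainders. *)
Lemma jet_bound_series r (u : nat -> C -> C) (b : nat -> R) :
  (forall k, jet_bound r (b k) (u k)) -> ex_series b ->
  jet_bound r (Series b) (fun z => CSeries (fun k => u k z)).
Proof.
move=> /functional_choice[d H] bs.
exists (fun z => CSeries (fun k => d k z)) => z w zr wr.
have uS x : (Cmod x <= r)%R ->
    is_series (V := C_NormedModule) (fun k => u k x) (CSeries (fun k => u k x)).
  by move=> xr; apply: (is_series_CSeries _ b) => // k; case: (H k x x xr xr).
have dS : is_series (V := C_NormedModule) (fun k => d k z) (CSeries (fun k => d k z)).
  by apply: (is_series_CSeries _ b) => // k; case: (H k z z zr zr).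
split.
- apply: (Cmod_is_series_le _ _ b _ (uS z zr)) => // k.
  by case: (H k z z zr zr).
- apply: (Cmod_is_series_le _ _ b _ dS) => // k.
  by case: (H k z z zr zr).
rewrite -Series_scal_r.
apply: (Cmod_is_series_le
  (fun k => u k w - u k z - d k z * (w - z))); last exact: ex_series_scal_r.
- by move=> k; case: (H k z w zr wr).
have hS := is_series_scal (V := C_NormedModule) (w - z) _ _ dS.
have := is_series_minus _ _ _ _ (is_series_minus _ _ _ _ (uS w wr) (uS z zr)) hS.
rewrite /minus /plus /opp /scal /= /mult /= => S.
rewrite Cmult_comm.
by apply: is_series_ext S => k /=; rewrite (Cmult_comm (d k z)).
Qed.

(** The quadratic remainder on a disk containing [z] in its interior is
    o(|w - z|). *)
Lemma jet_bound_ex_derive u :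
  (forall r, (0 <= r)%R -> exists M, jet_bound r M u) -> entire u.
Proof.
move=> H z; have r0 : (0 <= Cmod z + 1)%R by have := Cmod_ge_0 z; lra.
have [M [d J]] := H _ r0.
exists (d z); split; first exact: is_linear_scal_l.
move=> x xl.
(* The derivative is tested along the neighbourhoods of [z], whose only limit is
   [z] itself. *)
have <- : z = x.
  exact: (is_filter_lim_locally_unique (V := AbsRing_NormedModule C_AbsRing)).
move=> eps {xl x}.
have zr : (Cmod z <= Cmod z + 1)%R by lra.
have [J1 _ _] := J z z zr zr.
have M0 : (0 <= M)%R by apply: Rle_trans J1; apply: Cmod_ge_0.
have e0 := cond_pos eps.
have del0 : (0 < Rmin 1 (eps / (M + 1)))%R.
  by apply: Rmin_pos; [lra | apply: Rdiv_lt_0_compat; lra].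
exists (mkposreal _ del0) => w /= wz.
have {wz} : (Cmod (w - z) < Rmin 1 (eps / (M + 1)))%R by exact: wz.
move=> wz.
have wz1 := Rlt_le_trans _ _ _ wz (Rmin_l _ _).
have wz2 := Rlt_le_trans _ _ _ wz (Rmin_r _ _).
have wr : (Cmod w <= Cmod z + 1)%R.
  replace w with (z + (w - z)) by ring.
  by apply: Rle_trans (Cmod_triangle _ _) _; lra.
have [_ _ J3] := J z w zr wr.
change (Cmod (u w - u z - (w - z) * d z) <= eps * Cmod (w - z))%R.
rewrite (Cmult_comm (w - z)); apply: Rle_trans J3 _.
have h0 := Cmod_ge_0 (w - z); set h := Cmod (w - z) in h0 wz2 *.
have : ((M + 1) * h <= eps)%R.
  apply: (Rmult_le_reg_r (/ (M + 1))); first by apply: Rinv_0_lt_compat; lra.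
  by field_simplify; [lra | lra | lra].
by nra.
Qed.

End JetBounds.

(** * The complex exponential *)

Section ComplexExponential.

Local Open Scope R_scope.

Lemma exp_le_exp (x y : R) : x <= y -> exp x <= exp y.
Proof.
by case/Rle_lt_or_eq_dec => [/exp_increasing/Rlt_le // | ->]; exact: Rle_refl.
Qed.

Lemma exp_Taylor1 (x : R) : Rabs (exp x - 1) <= Rabs x * exp (Rabs x).
Proof.
have E0 := exp_pos x; have E1 := exp_ineq1_le x.
have E2 := exp_ineq1_le (- x); rewrite exp_Ropp in E2.
have E3 := exp_ineq1_le (Rabs x).
have I : exp x * / exp x = 1 by field; lra.
case: (Rle_lt_dec 0 x) => x0.
  rewrite (Rabs_pos_eq x) // Rabs_pos_eq; nra.
rewrite (Rabs_left x) // in E3 *.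
have : exp x < 1 by rewrite -exp_0; apply: exp_increasing.
move=> H; rewrite Rabs_left; nra.
Qed.

Lemma exp_Taylor2 (x : R) : Rabs (exp x - 1 - x) <= x ^ 2 * exp (Rabs x).
Proof.
have E0 := exp_pos x; have E1 := exp_ineq1_le x.
rewrite Rabs_pos_eq; last lra.
have I : exp x * / exp x = 1 by field; lra.
have E2 := exp_ineq1_le (- x); rewrite exp_Ropp in E2.
case: (Rle_lt_dec 0 x) => x0.
  have := exp_Taylor1 x; rewrite !Rabs_pos_eq; [nra | done | lra].
have : exp x < 1 by rewrite -exp_0; apply: exp_increasing.
have E3 := exp_ineq1_le (Rabs x); have := Rabs_pos x.
nra.
Qed.

Lemma Rabs_sin_le (x : R) : Rabs (sin x) <= Rabs x.
Proof.
case: (MVT_gen sin 0 x cos) => [t _|t _|t [_]].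
- by auto_derive; [done | ring].
- by apply: continuity_sin.
rewrite sin_0 !Rminus_0_r => ->; rewrite Rabs_mult.
have : Rabs (cos t) <= 1 by apply: Rabs_le; exact: COS_bound.
have := Rabs_pos x; nra.
Qed.

Lemma cos_sub1 (x : R) : cos x - 1 = - (2 * (sin (x / 2) * sin (x / 2))).
Proof. by replace x with (2 * (x / 2)) at 1 by field; rewrite cos_2a_sin; ring. Qed.

Lemma Rabs_cos_sub1 (x : R) :
  Rabs (cos x - 1) = 2 * (Rabs (sin (x / 2)) * Rabs (sin (x / 2))).
Proof. by rewrite cos_sub1 Rabs_Ropp !Rabs_mult (Rabs_pos_eq 2); lra. Qed.

Lemma Rabs_sin_half_le (x : R) : Rabs (sin (x / 2)) <= Rabs x / 2.
Proof.
have := Rabs_sin_le (x / 2).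
by rewrite [Rabs (x / 2)]Rabs_mult (Rabs_pos_eq (/ 2)); lra.
Qed.

Lemma cos_Taylor1 (x : R) : Rabs (cos x - 1) <= Rabs x.
Proof.
rewrite Rabs_cos_sub1; have := Rabs_sin_half_le x.
have : Rabs (sin (x / 2)) <= 1 by apply: Rabs_le; exact: SIN_bound.
have := Rabs_pos (sin (x / 2)); nra.
Qed.

Lemma cos_Taylor2 (x : R) : Rabs (cos x - 1) <= x ^ 2.
Proof.
rewrite Rabs_cos_sub1 -(pow2_abs x); have := Rabs_sin_half_le x.
have := Rabs_pos (sin (x / 2)); have := Rabs_pos x; nra.
Qed.

Lemma sin_Taylor2 (x : R) : Rabs (sin x - x) <= x ^ 2.
Proof.
case: (MVT_gen (fun t => sin t - t) 0 x (fun t => cos t - 1)) => [t _|t _|t [tb]].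
- by auto_derive; [done | ring].
- by apply: continuity_pt_minus; [exact: continuity_sin | exact: continuity_pt_id].
rewrite sin_0 !Rminus_0_r => ->; rewrite Rabs_mult.
have : Rabs t <= Rabs x.
  move: tb; rewrite /Rmin /Rmax; case: Rle_dec => x0 tb.
    by rewrite !Rabs_pos_eq; lra.
  by rewrite !Rabs_left1; lra.
have := cos_Taylor1 t; have := Rabs_pos x; rewrite -(pow2_abs x); nra.
Qed.

Lemma Cmod_le_Re_Im (z : C) : Cmod z <= Rabs (Re z) + Rabs (Im z).
Proof.
replace z with (RtoC (Re z) + Ci * RtoC (Im z))%C at 1.
  apply: Rle_trans (Cmod_triangle _ _) _.
  by rewrite Cmod_mult Cmod_Ci !Cmod_R; lra.
by apply: injective_projections; rewrite /= /Re /Im; ring.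
Qed.

Local Open Scope C_scope.

Lemma Cexp_add (z w : C) : Cexp (z + w) = Cexp z * Cexp w.
Proof.
apply: injective_projections; rewrite /= exp_plus ?cos_plus ?sin_plus /Re /Im; ring.
Qed.

Lemma Cexp_0 : Cexp 0 = 1.
Proof.
by apply: injective_projections; rewrite /= exp_0 ?cos_0 ?sin_0; ring.
Qed.

Lemma Cexp_opp_r (z : C) : Cexp z * Cexp (- z) = 1.
Proof. by rewrite -Cexp_add Cplus_opp_r Cexp_0. Qed.

Lemma Cexp_pow (z : C) (k : nat) : Cexp z ^ k = Cexp (INR k * z).
Proof.
elim: k => [|k IH]; first by rewrite /= Cmult_0_l Cexp_0.
rewrite Cpow_S IH -Cexp_add; congr Cexp.
by rewrite S_INR RtoC_plus; ring.
Qed.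

Lemma Cmod_Cexp_le (z : C) : (Cmod (Cexp z) <= exp (Cmod z))%R.
Proof.
have -> : Cmod (Cexp z) = exp (Re z).
  rewrite /Cmod /=.
  replace (_ + _)%R with (exp (Re z) ^ 2)%R.
    by rewrite sqrt_pow2 //; apply/Rlt_le/exp_pos.
  have := sin2_cos2 (Im z); rewrite /Rsqr => H.
  transitivity (exp (Re z) ^ 2 *
    (sin (Im z) * sin (Im z) + cos (Im z) * cos (Im z)))%R; last by ring.
  by rewrite H; ring.
by apply: exp_le_exp; apply: Rle_trans (Rle_abs _) (re_le_Cmod z).
Qed.

(** The one analytic fact about the complex exponential from which all jet bounds
    are derived. In coordinates it follows from the first order expansions of the
    real [exp], [cos] and [sin]. *)
Lemma Cexp_Taylor2 (z : C) :
  (Cmod (Cexp z - 1 - z) <= 3 * Cmod z ^ 2 * exp (Cmod z))%R.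
Proof.
have M2 := Cmod2_alt z; have reM := re_le_Cmod z.
have xM := exp_le_exp _ _ reM.
apply: Rle_trans (Cmod_le_Re_Im _) _.
rewrite M2; move: (Cmod z) xM => m xM {M2 reM}.
case: z xM => x y /= xM; rewrite /Re /Im /=.
set E := exp (Rabs x) in xM.
have E1 : (1 <= E)%R.
  by have := exp_ineq1_le (Rabs x); have := Rabs_pos x; rewrite /E; lra.
have ex := exp_le_exp _ _ (Rle_abs x); have ex0 := exp_pos x.
have T1 := exp_Taylor1 x; have T2 := exp_Taylor2 x.
have C2 := cos_Taylor2 y; have S2 := sin_Taylor2 y.
rewrite -/E in ex T1 T2.
have re : (Rabs (exp x * cos y + - (1) + - x) <= E * (x ^ 2 + y ^ 2))%R.
  replace (_ + _ + _)%R with (exp x * (cos y - 1) + (exp x - 1 - x))%R by ring.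
  apply: Rle_trans (Rabs_triang _ _) _.
  rewrite Rabs_mult (Rabs_pos_eq (exp x)); last lra.
  have := Rabs_pos (cos y - 1); nra.
have im : (Rabs (exp x * sin y + - 0 + - y) <= E * (y ^ 2 + Rabs x * Rabs y))%R.
  replace (_ + _ + _)%R with (exp x * (sin y - y) + (exp x - 1) * y)%R by ring.
  apply: Rle_trans (Rabs_triang _ _) _.
  rewrite !Rabs_mult (Rabs_pos_eq (exp x)); last lra.
  have := Rabs_pos (sin y - y); have := Rabs_pos y; nra.
have xy : (Rabs x * Rabs y <= (x ^ 2 + y ^ 2) / 2)%R.
  rewrite -(pow2_abs x) -(pow2_abs y); have := pow2_ge_0 (Rabs x - Rabs y); nra.
have x2 := pow2_ge_0 x; have y2 := pow2_ge_0 y.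
have : (E * (Rabs x * Rabs y) <= E * ((x ^ 2 + y ^ 2) / 2))%R.
  by apply: Rmult_le_compat_l => //; lra.
have := Rmult_le_compat_l _ _ _ (Rplus_le_le_0_compat _ _ x2 y2) xM.
have : (0 <= E * x ^ 2)%R by apply: Rmult_le_pos => //; lra.
have : (0 <= E * y ^ 2)%R by apply: Rmult_le_pos => //; lra.
by rewrite -/E; lra.
Qed.

Lemma Cexp_imag (t : R) : Cexp (Ci * t) = (cos t, sin t).
Proof.
rewrite /Cexp; replace (Re (Ci * t)) with 0%R by (rewrite /Re /=; ring).
replace (Im (Ci * t)) with t by (rewrite /Im /=; ring).
by rewrite exp_0 !Rmult_1_l.
Qed.

End ComplexExponential.

(** * Second order bounds for exponentials *)

Section ScaledExponentials.

Local Open Scope C_scope.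

Implicit Types (a z : C) (r c : R).

(** Dividing by [a] keeps these functions, which tend to the identity as [a] tends
    to 0, bounded on disks uniformly in bounded [a]; the factors [a] taken out are
    the powers of 1/n in the estimates for [phi n]. *)
Definition cexpm1 a z : C := (Cexp (a * z) - 1) / a.

Lemma cexpm1_approx a z : a <> 0 ->
  (Cmod (cexpm1 a z - z) <= 3 * Cmod a * Cmod z ^ 2 * exp (Cmod a * Cmod z))%R.
Proof.
move=> a0; have a1 : (0 < Cmod a)%R by apply/Cmod_gt_0.
replace (cexpm1 a z - z) with ((Cexp (a * z) - 1 - a * z) / a); last first.
  by rewrite /cexpm1; field.
rewrite Cmod_div //; apply: (Rmult_le_reg_r (Cmod a)) => //.
replace (_ / _ * _)%R with (Cmod (Cexp (a * z) - 1 - a * z)) by (field; lra).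
have := Cexp_Taylor2 (a * z); rewrite Cmod_mult; lra.
Qed.

(** By the functional equation of the exponential the remainder at [z] with
    increment [h] is [Cexp (a * z)] times the remainder [cexpm1 a h - h] at the
    origin. *)
Lemma jet_bound_cexpm1 r c : (0 <= r)%R -> (0 <= c)%R -> exists M,
  forall a, a <> 0 -> (Cmod a <= c)%R -> jet_bound r M (cexpm1 a).
Proof.
move=> r0 c0; set E := exp (c * r); set F := exp (c * (2 * r)).
have E1 : (0 < E)%R := exp_pos _; have F1 : (0 < F)%R := exp_pos _.
have cE : (0 <= c * E)%R by nra.
have cEF : (0 <= c * E * F)%R by nra.
have r2 := pow2_ge_0 r.
have cEr : (0 <= c * r ^ 2 * E)%R by nra.
exists (r + 3 * c * r ^ 2 * E + E + 3 * c * E * F)%R => a a0 ac.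
have a1 : (0 < Cmod a)%R by apply/Cmod_gt_0.
have expb x s : (Cmod x <= s)%R -> (exp (Cmod a * Cmod x) <= exp (c * s))%R.
  move=> xs; apply: exp_le_exp.
  by apply: Rmult_le_compat => //; [lra | exact: Cmod_ge_0].
exists (fun z => Cexp (a * z)) => z w zr wr; split.
- replace (cexpm1 a z) with (z + (cexpm1 a z - z)) by ring.
  apply: Rle_trans (Cmod_triangle _ _) _.
  have T := cexpm1_approx a z a0.
  suff : (3 * Cmod a * Cmod z ^ 2 * exp (Cmod a * Cmod z) <= 3 * c * r ^ 2 * E)%R.
    by lra.
  apply: Rmult_le_compat; try exact: expb.
  + by apply: Rmult_le_pos; [lra | exact: pow2_ge_0].
  + by apply/Rlt_le/exp_pos.
  apply: Rmult_le_compat; [lra | exact: pow2_ge_0 | lra |].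
  by apply: pow_incr; split=> //; exact: Cmod_ge_0.
- apply: Rle_trans (Cmod_Cexp_le _) _; rewrite Cmod_mult.
  by apply: Rle_trans (expb _ _ zr) _; rewrite -/E; lra.
set h := w - z.
have hr : (Cmod h <= 2 * r)%R.
  by apply: Rle_trans (Cmod_triangle _ _) _; rewrite Cmod_opp; lra.
replace (cexpm1 a w - cexpm1 a z - Cexp (a * z) * h) with
  (Cexp (a * z) * (cexpm1 a h - h)); last first.
  rewrite /cexpm1; replace (a * w) with (a * z + a * h) by (rewrite /h; ring).
  by rewrite Cexp_add; field.
rewrite Cmod_mult; have := cexpm1_approx a h a0.
have := Cmod_Cexp_le (a * z); rewrite Cmod_mult => Ez T.
have h2 := pow2_ge_0 (Cmod h).
have ET := Rmult_le_compat _ _ _ _ (Cmod_ge_0 _) (Cmod_ge_0 _)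
  (Rle_trans _ _ _ Ez (expb _ _ zr)) T.
apply: Rle_trans ET _; rewrite -/E.
apply: (Rle_trans _ (3 * c * E * F * Cmod h ^ 2)); last first.
  by apply: Rmult_le_compat_r => //; lra.
replace (E * _)%R with (E * Cmod h ^ 2 * 3 * (Cmod a * exp (Cmod a * Cmod h)))%R by ring.
replace (3 * c * E * F * Cmod h ^ 2)%R with (E * Cmod h ^ 2 * 3 * (c * F))%R by ring.
apply: Rmult_le_compat_l; first by nra.
by apply: Rmult_le_compat => //; [lra | apply/Rlt_le/exp_pos | exact: expb].
Qed.

Lemma jet_bound_Cexp r c : (0 <= r)%R -> (0 <= c)%R -> exists M,
  forall a, (Cmod a <= c)%R -> jet_bound r M (fun z => Cexp (a * z)).
Proof.
move=> r0 c0; have [M H] := jet_bound_cexpm1 r c r0 c0.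
exists (1 + c * Rabs M)%R => a ac.
case: (Ceq_dec a 0) => [-> | a0].
  apply: (jet_bound_le _ (Cmod 1)); last first.
    apply: jet_bound_ext (jet_bound_const r 1) => z _.
    by rewrite Cmult_0_l Cexp_0.
  by rewrite Cmod_1; have := Rabs_pos M; nra.
apply: (jet_bound_le _ (Cmod 1 + Cmod a * M)).
  rewrite Cmod_1; apply: Rplus_le_compat_l.
  have := Rle_abs M; have := Rabs_pos M; have := Cmod_ge_0 a; nra.
apply: jet_bound_ext (jet_bound_add _ _ _ _ _ (jet_bound_const r 1)
  (jet_bound_scal _ _ a _ (H a a0 ac))) => z _.
by rewrite /cexpm1; field.
Qed.

End ScaledExponentials.

(** * The normalised Fejer kernel *)

Section FejerKernel.

Local Open Scope C_scope.

Fixpoint geom (q : C) (n : nat) : C :=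
  if n is m.+1 then geom q m + q ^ m else 0.

Lemma geomSl (q : C) (n : nat) : geom q n.+1 = 1 + q * geom q n.
Proof.
elim: n => [|n IH]; first by rewrite /=; ring.
by rewrite -[geom q n.+2]/(geom q n.+1 + q ^ n.+1) {1}IH Cpow_S /=; ring.
Qed.

Lemma geom_telescope (q : C) (n : nat) : (q - 1) * geom q n = q ^ n - 1.
Proof.
elim: n => [|n IH]; first by rewrite /=; ring.
by rewrite /= Cmult_plus_distr_l IH; ring.
Qed.

Lemma geom_1 (n : nat) : geom 1 n = INR n.
Proof.
elim: n => [|n IH]; first by [].
by rewrite S_INR RtoC_plus /= IH Cpow_1_l.
Qed.

Lemma geom_double (q : C) (n : nat) : geom q (2 * n) = (1 + q) * geom (q * q) n.
Proof.
elim: n => [|n IH]; first by rewrite /=; ring.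
have E : q ^ (2 * n) = (q * q) ^ n.
  by rewrite mul2n -addnn Cpow_mult_l -Cpow_add_r.
by rewrite mulnS [(2 + _)%N]/= /= IH E; ring.
Qed.

Let C_plusE (x y : C) : plus x y = x + y.
Proof. by []. Qed.

Lemma geom_reverse (q p : C) (n : nat) : q * p = 1 ->
  p ^ n * geom q n = sum_n_m (fun k => p ^ k) 1 n.
Proof.
move=> qp; elim: n => [|n IH].
  by rewrite sum_n_m_zero /=; [rewrite Cmult_0_r | apply/ltP].
rewrite sum_n_Sm; last by apply/leP.
rewrite -IH geomSl Cpow_S /plus /=.
have -> : p * p ^ n * (1 + q * geom q n) =
  p * p ^ n + (q * p) * (p ^ n * geom q n) by ring.
by rewrite qp; ring.
Qed.

(** The product of the two geometric sums, expanded along the diagonals: the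
    difference [k] of the exponents occurs [n + 1 - k] times. This is the classical
    factorisation of the Fejer kernel. *)
Lemma geom_mul_inv (q p : C) (n : nat) : q * p = 1 ->
  geom q n.+1 * geom p n.+1 =
  INR n.+1 + 2 * sum_n_m (fun k => INR (n.+1 - k)%N * ((q ^ k + p ^ k) / 2)) 1 n.
Proof.
move=> qp; have pq : p * q = 1 by rewrite Cmult_comm.
elim: n => [|n IH].
  rewrite sum_n_m_zero /=; last by apply/ltP.
  by rewrite /zero /=; ring.
have qpn : q ^ n.+1 * p ^ n.+1 = 1 by rewrite -Cpow_mult_l qp Cpow_1_l.
have -> : geom q n.+2 * geom p n.+2 = geom q n.+1 * geom p n.+1 +
   p ^ n.+1 * geom q n.+1 + q ^ n.+1 * geom p n.+1 + q ^ n.+1 * p ^ n.+1.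
  by rewrite -[geom q n.+2]/(geom q n.+1 + q ^ n.+1)
             -[geom p n.+2]/(geom p n.+1 + p ^ n.+1); ring.
rewrite qpn (geom_reverse q p) // (geom_reverse p q) // IH.
rewrite [X in _ = _ + 2 * X]sum_n_Sm; last by apply/leP.
rewrite [X in _ = _ + 2 * plus X _](sum_n_m_ext_loc _ (fun k => plus
   (INR (n.+1 - k)%N * ((q ^ k + p ^ k) / 2)) ((q ^ k + p ^ k) / 2))); last first.
  move=> k [_ /leP kn]; rewrite subSn; last by apply: leqW.
  by rewrite S_INR RtoC_plus /plus /=; ring.
rewrite sum_n_m_plus.
have -> : sum_n_m (fun k => (q ^ k + p ^ k) / 2) 1 n =
   (sum_n_m (fun k => q ^ k) 1 n + sum_n_m (fun k => p ^ k) 1 n) / 2.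
  elim: n {IH qpn} => [|n IH].
    by rewrite !sum_n_m_zero; [rewrite /zero /=; field | apply/ltP..].
  by rewrite !sum_n_Sm; [rewrite IH /plus /=; field | apply/leP..].
rewrite !sum_n_Sm; try by apply/leP.
rewrite [INR n.+2]S_INR RtoC_plus subSn // subnn !C_plusE [INR 1]/=.
field.
Qed.

(** [Cexp (freq n * z)] is the common ratio of the geometric sums that factor
    [Fker z n]. *)
Definition freq (n : nat) : C := 2 * PI * Ci / INR n.

Lemma INR_neq0 (n : nat) : (0 < n)%N -> RtoC (INR n) <> 0.
Proof.
by move=> n0 /RtoC_inj; apply: not_0_INR => n00; rewrite n00 in n0.
Qed.

Lemma INR_double (n : nat) : INR (2 * n) = (2 * INR n)%R.
Proof. by rewrite mult_INR. Qed.

Lemma Cmod_freq (n : nat) : (0 < n)%N -> Cmod (freq n) = (2 * PI / INR n)%R.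
Proof.
move=> n0; rewrite Cmod_div; last exact: INR_neq0.
rewrite !Cmod_mult Cmod_Ci !Cmod_R !Rabs_pos_eq ?Rmult_1_r //.
- exact: pos_INR.
- by have := PI_RGT_0; lra.
- by lra.
Qed.

Lemma freq_neq0 (n : nat) : (0 < n)%N -> freq n <> 0.
Proof.
move=> n0; apply/Cmod_gt_0; rewrite Cmod_freq //.
have := PI_RGT_0; have := lt_0_INR _ (elimT ltP n0) => nn pp.
by apply: Rdiv_lt_0_compat; lra.
Qed.

Lemma phi_geom (n : nat) (z : C) : (0 < n)%N ->
  phi n z = geom (Cexp (freq n * z)) n * geom (Cexp (- (freq n * z))) n / INR n ^ 2.
Proof.
case: n => // n _; rewrite /phi; congr (_ / _).
rewrite geom_mul_inv; last exact: Cexp_opp_r.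
rewrite /Fker; case: n => [|n].
  rewrite /= sum_n_m_zero; last by apply/ltP.
  by rewrite /zero /=; ring.
rewrite [_ == _]/=; congr (_ + 2 * _); rewrite subn1 [_.-1]/=.
apply: sum_n_m_ext => k; congr (_ * _); rewrite /Ccos.
have nz : RtoC (INR n.+2) <> 0 by exact: INR_neq0.
have -> : Ci * (2 * PI * INR k * z / INR n.+2) = INR k * (freq n.+2 * z).
  by rewrite /freq; field.
rewrite !Cexp_pow; congr ((_ + Cexp _) / 2); ring.
Qed.

(** The key identity. In trigonometric form it reads
    [phi (2n) z = phi n z * cos^2 (pi z / 2n)], because a geometric sum of length
    [2n] and ratio [q] is [1 + q] times the one of length [n] and ratio [q^2].
    Hence the difference is [phi n z * sin^2 (pi z / 2n)], and the sine is written
    with [cexpm1] to expose its size 1/n. *)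
Lemma phi_double (n : nat) (z : C) : (0 < n)%N ->
  phi n z - phi (2 * n) z =
  freq (2 * n) ^ 2 / 4 *
    (phi n z * (cexpm1 (freq (2 * n)) z * cexpm1 (freq (2 * n)) (- z))).
Proof.
move=> n0; have n20 : (0 < 2 * n)%N by rewrite muln_gt0.
have nz := INR_neq0 n n0; have a0 := freq_neq0 _ n20.
have E : freq n * z = freq (2 * n) * z + freq (2 * n) * z.
  by rewrite /freq INR_double RtoC_mult; field.
rewrite !phi_geom // !geom_double E Copp_plus_distr !Cexp_add /cexpm1.
replace (freq (2 * n) * - z) with (- (freq (2 * n) * z)) by ring.
have := Cexp_opp_r (freq (2 * n) * z).
rewrite INR_double RtoC_mult.
set q := Cexp (freq (2 * n) * z); set p := Cexp (- _) => qp.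
set g := geom _ _; set h := geom _ _.
have -> : g * h / INR n ^ 2 - (1 + q) * g * ((1 + p) * h) / (2 * INR n) ^ 2 =
  g * h / INR n ^ 2 * (3 - q - p - q * p) / 4 by field.
have -> : freq (2 * n) ^ 2 / 4 * (g * h / INR n ^ 2 *
    ((q - 1) / freq (2 * n) * ((p - 1) / freq (2 * n)))) =
  g * h / INR n ^ 2 * (q * p - q - p + 1) / 4 by field.
by rewrite qp; congr (_ * _ / _); ring.
Qed.

Lemma jet_bound_geom (r M c : R) (n : nat) (a : C) :
  (forall b, (Cmod b <= c)%R -> jet_bound r M (fun z => Cexp (b * z))) ->
  (INR n * Cmod a <= c)%R -> jet_bound r (INR n * M) (fun z => geom (Cexp (a * z)) n).
Proof.
move=> H; elim: n => [|n IH] nc.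
  apply: (jet_bound_le _ (Cmod 0)); first by rewrite Cmod_0 /=; lra.
  exact: jet_bound_const.
have a0 := Cmod_ge_0 a; move: nc; rewrite S_INR => nc.
rewrite Rmult_plus_distr_r Rmult_1_l /=.
apply: jet_bound_add; first by apply: IH; lra.
apply: (jet_bound_ext _ _ (fun z => Cexp ((INR n * a) * z))).
  by move=> z _; rewrite Cexp_pow Cmult_assoc.
apply: H; rewrite Cmod_mult Cmod_R Rabs_pos_eq; last exact: pos_INR.
by lra.
Qed.

(** Each of the two factors of [phi n] is an average of [n] exponentials whose
    frequencies are at most [2 pi], so one constant serves all [n]. *)
Lemma jet_bound_phi (r : R) : (0 <= r)%R ->
  exists M, forall n, (0 < n)%N -> jet_bound r M (phi n).
Proof.
move=> r0; have pi0 := PI_RGT_0.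
have c0 : (0 <= 2 * PI)%R by lra.
have [M H] := jet_bound_Cexp r _ r0 c0.
exists ((3 + 2 * r) * (M * M))%R => n n0.
have nn : (0 < INR n)%R by apply: lt_0_INR; apply/ltP.
have J : jet_bound r M (fun z => / INR n * geom (Cexp (freq n * z)) n).
  apply: (jet_bound_le _ (Cmod (/ INR n) * (INR n * M))).
    rewrite Cmod_inv; last exact: INR_neq0.
    rewrite Cmod_R Rabs_pos_eq; last lra.
    by apply: Req_le; field; lra.
  apply: jet_bound_scal; apply: jet_bound_geom H _.
  by rewrite Cmod_freq //; apply: Req_le; field; lra.
apply: jet_bound_ext (jet_bound_mul _ _ _ _ _ J (jet_bound_opp _ _ _ J)) => z _.
rewrite phi_geom //.
replace (freq n * - z) with (- (freq n * z)) by ring.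
by field; exact: INR_neq0.
Qed.

Lemma jet_bound_phi_double (r : R) : (0 <= r)%R ->
  exists M, forall n, (0 < n)%N ->
    jet_bound r (M / INR n ^ 2) (fun z => phi n z - phi (2 * n) z).
Proof.
move=> r0; have pi0 := PI_RGT_0.
have c0 : (0 <= 2 * PI)%R by lra.
have [M H] := jet_bound_phi r r0; have [K G] := jet_bound_cexpm1 r _ r0 c0.
set L := ((3 + 2 * r) * (M * ((3 + 2 * r) * (K * K))))%R.
exists (PI ^ 2 / 4 * L)%R => n n0.
have n20 : (0 < 2 * n)%N by rewrite muln_gt0.
have nn : (1 <= INR n)%R by apply: (le_INR 1); apply/leP.
have fE : Cmod (freq (2 * n)) = (PI / INR n)%R.
  by rewrite Cmod_freq // INR_double; field; lra.
have J : jet_bound r K (cexpm1 (freq (2 * n))).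
  apply: G; first exact: freq_neq0.
  rewrite fE; apply: (Rmult_le_reg_r (INR n)); first lra.
  by replace (PI / INR n * INR n)%R with PI by (field; lra); nra.
have := jet_bound_scal _ _ (freq (2 * n) ^ 2 / 4) _ (jet_bound_mul _ _ _ _ _ (H n n0)
  (jet_bound_mul _ _ _ _ _ J (jet_bound_opp _ _ _ J))).
rewrite -/L Cmod_div; last by move=> /RtoC_inj; lra.
rewrite Cmod_pow fE Cmod_R (Rabs_pos_eq 4); last lra.
move=> B; apply: (jet_bound_ext _ _ _ _ (fun z _ => esym (phi_double n z n0))).
by apply: jet_bound_le B; apply: Req_le; field; lra.
Qed.

(** The closed form [phi n z = (sin (pi z) / (n sin (pi z / n)))^2], cleared of
    denominators so that it holds for every [z]. *)
Lemma phi_mul (n : nat) (z : C) : (0 < n)%N ->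
  phi n z * (2 * PI * Ci) ^ 2 * (cexpm1 (freq n) z * cexpm1 (freq n) (- z)) =
  (Cexp (2 * PI * Ci * z) - 1) * (Cexp (- (2 * PI * Ci * z)) - 1).
Proof.
move=> n0; have nz := INR_neq0 n n0; have a0 := freq_neq0 _ n0.
have E : 2 * PI * Ci = INR n * freq n by rewrite /freq; field.
rewrite phi_geom // E /cexpm1.
replace (freq n * - z) with (- (freq n * z)) by ring.
replace (INR n * freq n * z) with (INR n * (freq n * z)) by ring.
replace (- (INR n * (freq n * z))) with (INR n * - (freq n * z)) by ring.
rewrite -!Cexp_pow -!geom_telescope; field; by split.
Qed.

Lemma phi_oo_mul (z : C) :
  phi_oo z * (2 * PI * Ci) ^ 2 * (z * - z) =
  (Cexp (2 * PI * Ci * z) - 1) * (Cexp (- (2 * PI * Ci * z)) - 1).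
Proof.
rewrite /phi_oo; case: Ceq_dec => [z0|z0] /=.
  by rewrite z0 Cmult_0_r Cexp_0; ring.
have pi0 : RtoC PI <> 0 by move=> /RtoC_inj; have := PI_RGT_0; lra.
have ci0 : Ci <> 0 by move=> /(f_equal snd) /=; lra.
rewrite /Csin.
have -> : 2 * PI * Ci * z = Ci * (PI * z) + Ci * (PI * z) by ring.
rewrite Copp_plus_distr !Cexp_add.
have := Cexp_opp_r (Ci * (PI * z)).
set q := Cexp (Ci * (PI * z)); set p := Cexp (- _) => qp.
have -> : ((q - p) / (2 * Ci) / (PI * z)) ^ 2 * (2 * PI * Ci) ^ 2 * (z * - z) =
   - (q - p) ^ 2 by field; split.
have -> : (q * q - 1) * (p * p - 1) = (q * p) * (q * p) - q * q - p * p + 1 by ring.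
have -> : - (q - p) ^ 2 = 2 * (q * p) - q * q - p * p by ring.
by rewrite qp; ring.
Qed.

End FejerKernel.

(** * Comparison with the limit kernel *)

Section Renormalisation.

Local Open Scope C_scope.

Lemma phi_0 (n : nat) : (0 < n)%N -> phi n 0 = 1.
Proof.
move=> n0; rewrite phi_geom // Cmult_0_r Copp_0 Cexp_0 geom_1.
by field; exact: INR_neq0.
Qed.

Lemma phi_oo_0 : phi_oo 0 = 1.
Proof. by rewrite /phi_oo; case: Ceq_dec. Qed.

Lemma two_pi_i_neq0 : 2 * PI * Ci <> 0.
Proof.
by apply/Cmod_gt_0; rewrite !Cmod_mult Cmod_Ci !Cmod_R !Rabs_pos_eq;
  have := PI_RGT_0; lra.
Qed.

(** By [phi_mul] and [phi_oo_mul] the functions [phi n] and [phi_oo] differ only in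
    the factor [cexpm1 (freq n) z], which is [z] up to O(1/n). The constant depends
    badly on [z] near 0, so this gives only pointwise convergence; it serves to
    identify the sum in [jet_bound_phi_renorm]. *)
Lemma phi_cvg (z : C) : exists K : R, forall n, (0 < n)%N ->
  (Cmod (phi n z - phi_oo z) <= K / INR n)%R.
Proof.
case: (Ceq_dec z 0) => [-> | z0].
  exists 0%R => n n0; rewrite phi_0 // phi_oo_0.
  by replace (1 - 1) with (RtoC 0) by ring; rewrite Cmod_0; lra.
have z1 : (0 < Cmod z)%R by apply/Cmod_gt_0.
have pi0 := PI_RGT_0; have c0 : (0 <= 2 * PI)%R by lra.
set r := Cmod z in z1 *; have r0 := Rlt_le _ _ z1.
have [M H] := jet_bound_phi r r0; have [K G] := jet_bound_cexpm1 r _ r0 c0.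
set D := (3 * (2 * PI) * r ^ 2 * exp (2 * PI * r))%R.
exists (M * (D * K + r * D) / r ^ 2)%R => n n0.
have nn : (1 <= INR n)%R by apply: (le_INR 1); apply/leP.
have a0 := freq_neq0 n n0; have aE := Cmod_freq n n0.
have a2 : (Cmod (freq n) <= 2 * PI)%R.
  rewrite aE; apply: (Rmult_le_reg_r (INR n)); first lra.
  by replace (2 * PI / INR n * INR n)%R with (2 * PI)%R by (field; lra); nra.
have T x : Cmod x = r -> (Cmod (cexpm1 (freq n) x - x) <= D / INR n)%R.
  move=> xr; apply: Rle_trans (cexpm1_approx _ x a0) _; rewrite xr.
  replace (D / INR n)%R with
    (3 * Cmod (freq n) * r ^ 2 * exp (2 * PI * r))%R by (rewrite aE /D; field; lra).
  apply: Rmult_le_compat_l.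
    by have := Cmod_ge_0 (freq n); have := pow2_ge_0 r; nra.
  by apply: exp_le_exp; apply: Rmult_le_compat_r.
have T1 := T z erefl; have T2 := T (- z) (Cmod_opp z).
have zr : (Cmod z <= r)%R by exact: Rle_refl.
have nzr : (Cmod (- z) <= r)%R by rewrite Cmod_opp.
have [_ /(_ _ _ zr zr)[P _ _]] := H n n0.
have [_ /(_ _ _ nzr nzr)[Q _ _]] := G _ a0 a2.
have E : (phi n z - phi_oo z) * z ^ 2 =
  phi n z * ((cexpm1 (freq n) z - z) * cexpm1 (freq n) (- z) +
             z * (cexpm1 (freq n) (- z) - - z)).
  have := phi_mul n z n0; rewrite -phi_oo_mul.
  set X := cexpm1 _ z; set Y := cexpm1 _ (- z) => F.
  have {}F : phi n z * (X * Y) = phi_oo z * (z * - z).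
    have k0 := two_pi_i_neq0; move: F k0; move: (2 * PI * Ci) => k F k0.
    replace (phi n z * (X * Y)) with (phi n z * k ^ 2 * (X * Y) / k ^ 2) by (by field).
    by rewrite F; field.
  transitivity (phi n z * z ^ 2 + phi_oo z * (z * - z)); first ring.
  by rewrite -F; ring.
have {}E : (Cmod (phi n z - phi_oo z) * r ^ 2 <=
            M * ((D / INR n) * K + r * (D / INR n)))%R.
  rewrite -Cmod_pow -Cmod_mult E Cmod_mult.
  apply: Rmult_le_compat; [exact: Cmod_ge_0 | exact: Cmod_ge_0 | done |].
  apply: Rle_trans (Cmod_triangle _ _) _; rewrite (Cmod_mult (_ - _)) (Cmod_mult z).
  apply: Rplus_le_compat.
    apply: Rmult_le_compat; [exact: Cmod_ge_0 | exact: Cmod_ge_0 | exact: T1 | exact: Q].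
  by apply: Rmult_le_compat_l.
have r2 : (0 < r ^ 2)%R by apply: pow_lt.
apply: (Rmult_le_reg_r (r ^ 2)) => //; apply: Rle_trans E _.
by apply: Req_le; field; lra.
Qed.

Lemma INR_pow2_mul (j n : nat) : INR (2 ^ j * n) = (2 ^ j * INR n)%R.
Proof.
elim: j => [|j IH]; first by rewrite expn0 mul1n /= Rmult_1_l.
by rewrite expnS -mulnA INR_double IH /= Rmult_assoc.
Qed.

Lemma sum_phi_double (n N : nat) (z : C) :
  sum_n (fun j => phi (2 ^ j * n) z - phi (2 * (2 ^ j * n)) z) N =
  phi n z - phi (2 ^ N.+1 * n) z.
Proof.
elim: N => [|N IH]; first by rewrite sum_O expn0 mul1n expn1.
by rewrite sum_Sn IH [in RHS]expnS -mulnA /plus /=; ring.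
Qed.

(** The difference telescopes along the doubling sequence [n, 2n, 4n, ...], and the
    [j]-th increment is O(1/(2^j n)^2) by [jet_bound_phi_double], so the sum of the
    increments is dominated by a geometric series. *)
Lemma jet_bound_phi_renorm (r : R) : (0 <= r)%R ->
  exists M, forall n, (0 < n)%N ->
    jet_bound r (M / INR n ^ 2) (fun z => phi n z - phi_oo z).
Proof.
move=> r0; have [M H] := jet_bound_phi_double r r0.
exists (M * Series (pow (1 / 4)))%R => n n0.
have nn : (1 <= INR n)%R by apply: (le_INR 1); apply/leP.
pose b j := (M / INR n ^ 2 * (1 / 4) ^ j)%R.
have bs : ex_series b.
  by apply: ex_series_scal_l; apply: ex_series_geom; rewrite Rabs_pos_eq; lra.
have J j : jet_bound r (b j) (fun z => phi (2 ^ j * n) z - phi (2 * (2 ^ j * n)) z).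
  have jn : (0 < 2 ^ j * n)%N by rewrite muln_gt0 expn_gt0.
  apply: jet_bound_le (H _ jn); rewrite INR_pow2_mul /b; apply: Req_le.
  have -> : ((1 / 4) ^ j = / (2 ^ j * 2 ^ j))%R.
    rewrite -Rpow_mult_distr; replace (2 * 2)%R with 4%R by ring.
    by rewrite -pow_inv; congr (_ ^ _)%R; lra.
  have j0 : (2 ^ j)%R <> 0%R by apply: pow_nonzero; lra.
  by field; repeat split=> //; lra.
replace (M * Series (pow (1 / 4)) / INR n ^ 2)%R with (Series b); last first.
  by rewrite /b Series_scal_l; field; lra.
apply: jet_bound_ext (jet_bound_series r _ b J bs) => z zr.
pose u j := phi (2 ^ j * n) z - phi (2 * (2 ^ j * n)) z.
rewrite -/(CSeries u); set L := CSeries u.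
have ub j : (Cmod (u j) <= b j)%R by have [d /(_ z z zr zr)[]] := J j.
have [K cvg] := phi_cvg z.
suff : (Cmod (L - (phi n z - phi_oo z)) <= 0)%R.
  move=> L0; have /Cmod_eq_0 E : Cmod (L - (phi n z - phi_oo z)) = 0%R.
    by apply: Rle_antisym => //; exact: Cmod_ge_0.
  replace L with (L - (phi n z - phi_oo z) + (phi n z - phi_oo z)) by ring.
  by rewrite E; ring.
have lim : is_lim_seq (fun N => Series b - sum_n b N + Rabs K * (1 / 2) ^ N)%R
    (Series b - Series b + Rabs K * 0)%R.
  apply: is_lim_seq_plus'.
    apply: is_lim_seq_minus'; first exact: is_lim_seq_const.
    exact: Series_correct.
  apply: is_lim_seq_mult'; first exact: is_lim_seq_const.
  by apply: is_lim_seq_geom; rewrite Rabs_pos_eq; lra.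
replace (Series b - Series b + Rabs K * 0)%R with 0%R in lim by ring.
apply: (is_lim_seq_le (fun _ => Cmod (L - (phi n z - phi_oo z))) _ _ _ _
  (is_lim_seq_const _) lim) => N.
replace (L - (phi n z - phi_oo z)) with
  (- (sum_n u N - L) + - (phi (2 ^ N.+1 * n) z - phi_oo z)); last first.
  by rewrite /u sum_phi_double; ring.
apply: Rle_trans (Cmod_triangle _ _) _; rewrite !Cmod_opp.
apply: Rplus_le_compat; first exact: CSeries_tail_le.
have jn : (0 < 2 ^ N.+1 * n)%N by rewrite muln_gt0 expn_gt0.
apply: Rle_trans (cvg _ jn) _; rewrite INR_pow2_mul.
have p0 : (0 < 2 ^ N.+1)%R by apply: pow_lt; lra.
have q0 : (0 < 2 ^ N)%R by apply: pow_lt; lra.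
apply: (Rle_trans _ (Rabs K * / (2 ^ N.+1 * INR n))).
  apply: Rmult_le_compat_r; last exact: Rle_abs.
  by apply/Rlt_le/Rinv_0_lt_compat; nra.
apply: Rmult_le_compat_l; first exact: Rabs_pos.
replace ((1 / 2) ^ N)%R with (/ 2 ^ N)%R; last first.
  by rewrite -pow_inv; congr (_ ^ _)%R; lra.
by apply: Rinv_le_contravar => //=; nra.
Qed.

Lemma Cexp_two_pi_nat (m : nat) : Cexp (2 * PI * Ci * INR m) = 1.
Proof.
have -> : 2 * PI * Ci * INR m = Ci * (0 + 2 * INR m * PI)%R.
  by rewrite RtoC_plus !RtoC_mult; ring.
by rewrite Cexp_imag cos_period sin_period cos_0 sin_0.
Qed.

(** At an integer [m] the ratio is an [n]-th root of unity, equal to 1 exactly when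
    [n] divides [m]; otherwise the geometric sum of length [n] vanishes. *)
Lemma phi_nat (n m : nat) : (0 < n)%N ->
  phi n (INR m) = if (n %| m)%N then 1 else 0.
Proof.
move=> n0; have nz := INR_neq0 n n0.
have nn : (1 <= INR n)%R by apply: (le_INR 1); apply/leP.
rewrite phi_geom //.
set q := Cexp (freq n * _).
have qn : q ^ n = 1.
  rewrite Cexp_pow -(Cexp_two_pi_nat m); congr Cexp.
  by rewrite /freq; field.
have qE : q = Cexp (Ci * (2 * PI * (INR (m %% n) / INR n))%R).
  have -> : q = Cexp (Ci * (2 * PI * (INR (m %% n) / INR n))%R) *
                Cexp (2 * PI * Ci * INR (m %/ n)).
    rewrite -Cexp_add; congr Cexp.
    have -> : RtoC (INR m) = INR (m %/ n) * INR n + INR (m %% n).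
      by rewrite -RtoC_mult -RtoC_plus -mult_INR -plus_INR {1}(divn_eq m n).
    rewrite /freq; move: PI => pi; rewrite /Rdiv !RtoC_mult RtoC_inv; last lra.
    by field.
  by rewrite Cexp_two_pi_nat Cmult_1_r.
case: ifPn => nm.
  move: qE; rewrite (eqP nm) [INR 0]/=.
  replace (2 * PI * (0 / INR n))%R with 0%R by (field; lra).
  rewrite Cmult_0_r Cexp_0 => qE.
  have -> : Cexp (- (freq n * INR m)) = 1.
    by have := Cexp_opp_r (freq n * INR m); rewrite -/q qE Cmult_1_l.
  by rewrite qE geom_1; field.
have q1 : q - 1 <> 0.
  move=> q1; have {}q1 : q = 1.
    by replace q with (q - 1 + 1) by ring; rewrite q1; ring.
  move: q1; rewrite qE Cexp_imag => /(f_equal fst) /=.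
  set t := (INR (m %% n) / INR n)%R.
  have t0 : (0 < t)%R.
    apply: Rdiv_lt_0_compat; last lra.
    by apply: lt_0_INR; apply/ltP; rewrite lt0n.
  have t1 : (t < 1)%R.
    apply: (Rmult_lt_reg_r (INR n)); first lra.
    replace (t * INR n)%R with (INR (m %% n)) by (rewrite /t; field; lra).
    by rewrite Rmult_1_l; apply: lt_INR; apply/ltP; rewrite ltn_mod.
  rewrite Rmult_assoc cos_2a_sin => c1; have pi0 := PI_RGT_0.
  have : (0 < sin (PI * t))%R by apply: sin_gt_0; nra.
  by nra.
have -> : geom q n = 0.
  replace (geom q n) with ((q - 1) * geom q n / (q - 1)) by (by field).
  by rewrite geom_telescope qn; field.
by field.
Qed.

Lemma phi_oo_nat (m : nat) : (0 < m)%N -> phi_oo (INR m) = 0.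
Proof.
move=> m0; have mz := INR_neq0 m m0; have k0 := two_pi_i_neq0.
have := phi_oo_mul (INR m); rewrite Cexp_two_pi_nat.
move: (2 * PI * Ci) k0 => k k0 H.
replace (phi_oo (INR m)) with
  (phi_oo (INR m) * k ^ 2 * (INR m * - INR m) / (k ^ 2 * (INR m * - INR m))) by (by field).
by rewrite H; field.
Qed.

End Renormalisation.

(** * Convergence of the majorant series *)

Section LogSeries.

Local Open Scope R_scope.

Lemma ex_series_bounded (b : nat -> R) (B : R) : (forall k, 0 <= b k) ->
  (forall N, sum_n b N <= B) -> ex_series b.
Proof.
move=> b0 bB.
case: (ex_finite_lim_seq_incr (sum_n b) B) => [N|//|l lim]; last by exists l.
by rewrite sum_Sn /plus /=; have := b0 N.+1; lra.
Qed.

(** From [ln x <= 2 * sqrt x] the terms are O(x^(-3/2)), which the increments of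
    1/sqrt x dominate, so the partial sums telescope. *)
Lemma ex_series_ln_div_sqr : ex_series (fun k => ln (INR k.+1) / INR k.+1 ^ 2).
Proof.
pose g k := / sqrt (INR k.+1).
have gpos k : 0 < g k by apply/Rinv_0_lt_compat/sqrt_lt_R0/lt_0_INR/ltP.
have x1 k : 1 <= INR k.+1 by apply: (le_INR 1); apply/leP.
apply: (ex_series_bounded _ (12 * g 0%N)) => [k|N].
  apply: Rdiv_le_0_compat; last by apply: pow_lt; have := x1 k; lra.
  by rewrite -ln_1; apply: ln_le => //; lra.
suff : sum_n (fun k => ln (INR k.+1) / INR k.+1 ^ 2) N <= 12 * (g 0%N - g N.+1).
  by have := gpos N.+1; lra.
(* With [s = sqrt x] and [t = sqrt (x + 1)], 1/s - 1/t = 1/(s t (s + t)), and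
   [t <= 2 s] bounds this below by 1/(6 s^3); the 12 is 2 times 6. *)
have step k : ln (INR k.+1) / INR k.+1 ^ 2 <= 12 * (g k - g k.+1).
  rewrite /g; move: (x1 k); rewrite (S_INR k.+1); move: (INR k.+1) => x {}x1.
  have s0 : 0 < sqrt x by apply: sqrt_lt_R0; lra.
  have t0 : 0 < sqrt (x + 1) by apply: sqrt_lt_R0; lra.
  have s2 : sqrt x * sqrt x = x by apply: sqrt_sqrt; lra.
  have t2 : sqrt (x + 1) * sqrt (x + 1) = x + 1 by apply: sqrt_sqrt; lra.
  have lnx : ln x <= 2 * sqrt x.
    rewrite -[X in ln X]s2 ln_mult //.
    have := exp_ineq1_le (ln (sqrt x)); rewrite exp_ln //; lra.
  move: (sqrt x) (sqrt (x + 1)) s0 t0 s2 t2 lnx => s t s0 t0 s2 t2 lnx.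
  have t2s : t <= 2 * s by nra.
  have tE : / s - / t = / (s * t * (s + t)).
    have -> : / s - / t = (t - s) * (t + s) / (s * t * (s + t)) by field; lra.
    have -> : (t - s) * (t + s) = 1 by lra.
    by rewrite /Rdiv Rmult_1_l.
  apply: (Rle_trans _ (2 * / (s ^ 3))).
    rewrite -s2; apply: (Rmult_le_reg_r (s ^ 4)); first exact: pow_lt.
    have -> : ln (s * s) / (s * s) ^ 2 * s ^ 4 = ln (s * s) by field; lra.
    have -> : 2 * / s ^ 3 * s ^ 4 = 2 * s by field; lra.
    by rewrite s2.
  have -> : 12 * (/ s - / t) = 2 * / (s * t * (s + t) / 6).
    by rewrite tE; field; lra.
  apply: Rmult_le_compat_l; first lra.
  have st : 0 < s * t by nra.
  apply: Rinv_le_contravar; first by nra.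
  have : s * t * (s + t) <= s * (2 * s) * (3 * s).
    by apply: Rmult_le_compat; nra.
  by lra.
elim: N => [|N IH]; first by rewrite sum_O.
rewrite sum_Sn; apply: Rle_trans (Rplus_le_compat _ _ _ _ IH (step N.+1)) _; lra.
Qed.

End LogSeries.

(** * The renormalised series *)

Theorem theorem3p8 :
  let f := dconv mobius vonMangoldt in
  (forall z : C, ex_series (fun k : nat => Cmod (ren_term f k.+1 z))) /\
  cvg_locally_uniformly
    (fun N z => sum_n (fun k : nat => ren_term f k.+1 z) N) (T_ren f) /\
  entire (T_ren f) /\
  (forall n : nat, (1 <= n)%N -> T_ren f (RtoC (INR n)) = RtoC (vonMangoldt n)).
Proof.
move=> f.
pose b (M : R) (k : nat) := (M * (ln (INR k.+1) / INR k.+1 ^ 2))%R.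
have bs M : ex_series (b M).
  by apply: ex_series_scal_l; exact: ex_series_ln_div_sqr.
have J r : (0 <= r)%R ->
    exists M, forall k, jet_bound r (b M k) (ren_term f k.+1).
  move=> r0; have [M H] := jet_bound_phi_renorm r r0; exists M => k.
  apply: jet_bound_le (jet_bound_scal _ _ (RtoC (f k.+1)) _ (H k.+1 isT)).
  have M0 : (0 <= M / INR k.+1 ^ 2)%R.
    have [d /(_ 0%C 0%C)[]] := H k.+1 isT; rewrite ?Cmod_0 // => H0 _ _.
    by apply: Rle_trans H0; exact: Cmod_ge_0.
  rewrite Cmod_R; apply: Rle_trans (Rmult_le_compat_r _ _ _ M0
    (dconv_mobius_vonMangoldt_bound k.+1 isT)) _.
  by apply: Req_le; rewrite /b /Rdiv; ring.
have bound r M k : (forall k, jet_bound r (b M k) (ren_term f k.+1)) ->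
    forall z, (Cmod z <= r)%R -> (Cmod (ren_term f k.+1 z) <= b M k)%R.
  by move=> H z zr; have [d /(_ z z zr zr)[]] := H k.
have abs_cvg z : ex_series (fun k : nat => Cmod (ren_term f k.+1 z)).
  have [M H] := J _ (Cmod_ge_0 z).
  apply: (ex_series_le (V := R_CompleteNormedModule) _ (b M)) => // k.
  rewrite /norm /= /abs /= Rabs_pos_eq; last exact: Cmod_ge_0.
  by apply: bound H _ _; exact: Rle_refl.
split=> //; split; [|split].
- move=> z0; exists (mkposreal 1 Rlt_0_1) => eps /=.
  have r0 : (0 <= Cmod z0 + 1)%R by have := Cmod_ge_0 z0; lra.
  have [M H] := J _ r0.
  have lim : is_lim_seq (sum_n (b M)) (Series (b M)) := Series_correct _ (bs M).
  have [N0 HN] := lim _ (locally_ball (Series (b M)) eps).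
  exists N0 => N NN z zz.
  have zr : (Cmod z <= Cmod z0 + 1)%R.
    replace z with (z0 + (z - z0))%C by ring.
    by apply: Rle_trans (Cmod_triangle _ _) _; lra.
  apply: Rle_lt_trans (CSeries_tail_le _ (b M) N _ (bs M)) _.
    by move=> k; exact: bound H _ zr.
  have := HN N NN; rewrite /ball /= /AbsRing_ball /abs /minus /plus /opp /=.
  by move/Rabs_def2; lra.
- apply: jet_bound_ex_derive => r r0; have [M H] := J r r0.
  by exists (Series (b M)); exact: jet_bound_series H (bs M).
move=> n n1.
(* Only the divisors of [n] contribute at [n]: the series becomes a finite sum. *)
pose c k := if (k.+1 %| n)%N then f k.+1 else 0%R.
have termE k : ren_term f k.+1 (INR n) = RtoC (c k).
  rewrite /ren_term phi_nat // phi_oo_nat // /c.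
  by case: ifP => _; rewrite ?RtoC_0; ring.
rewrite /T_ren /CSeries; congr pair; last first.
  rewrite (Series_ext _ (fun k => 0 * c k)%R); first by rewrite Series_scal_l Rmult_0_l.
  by move=> k; rewrite termE Rmult_0_l.
rewrite (Series_ext _ c); last by move=> k; rewrite termE.
have cs : ex_series c.
  apply: ex_series_Rabs; apply: ex_series_ext (abs_cvg (INR n)) => k.
  by rewrite termE Cmod_R.
have ctail k : c (n + k)%coq_nat = 0%R.
  rewrite /c; case: ifP => // /(dvdn_leq n1).
  by rewrite ltnNge leq_addr.
rewrite (Series_incr_n c n (elimT ltP n1) cs).
rewrite (Series_ext _ (fun k => 0 * c k)%R); last by move=> k; rewrite ctail Rmult_0_l.
rewrite Series_scal_l Rmult_0_l Rplus_0_r.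
have sumE N : sum_f_R0 c N = \big[Rplus/R0]_(0 <= k < N.+1) c k.
  elim: N => [|N IH]; first by rewrite big_nat1.
  by rewrite big_nat_recr //= -IH.
rewrite sumE prednK // -(sum_dconv_mobius vonMangoldt n n1) -/f.
transitivity (\big[Rplus/R0]_(1 <= i < n.+1 | i %| n) f i)%N.
  by rewrite [RHS]big_add1 /= [RHS]big_mkcond.
rewrite -[LHS]big_filter; apply: perm_big; apply: uniq_perm.
- by rewrite filter_uniq // iota_uniq.
- exact: divisors_uniq.
move=> i; rewrite mem_filter mem_index_iota -dvdn_divisors //.
case di: (i %| n) => //=; rewrite ltnS (dvdn_leq n1 di) andbT.
exact: dvdn_gt0 n1 di.
Qed.
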